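(* Let $f$ be a bounded multivariate rational function on $\mathbb{R}^n$, and let $\{\mathbf{x}_k\}_{k=1}^{\infty} \subset \mathbb{R}^n$ be a sequence of vectors in the domain of $f$ with a cluster point $\mathbf{x}^* \in \mathbb{R}^n$. Suppose that the following hold on the tail of the sequence: (i) there is $\sigma > 0$ such that for all sufficiently large $k$, $f(\mathbf{x}_k) - f(\mathbf{x}_{k+1}) \ge \sigma \|\nabla f(\mathbf{x}_k)\| \, \|\mathbf{x}_{k+1} - \mathbf{x}_k\|$; (ii) for all sufficiently large $k$, $f(\mathbf{x}_k) = f(\mathbf{x}_{k+1})$ implies $\mathbf{x}_k = \mathbf{x}_{k+1}$; (iii) the set $\mathcal{O}_{\mathbf{x}^*}$ contains every cluster point of the sequence $\left\{ \frac{\mathbf{x}_k - \mathbf{x}^*}{\|\mathbf{x}_k - \mathbf{x}^*\|} \right\}_{k \in \mathbb{N}}$; (iv) there is $\kappa > 0$ such that for all sufficiently large $k$, $\|\mathbf{x}_{k+1} - \mathbf{x}_k\| \ge \kappa \|\nabla f(\mathbf{x}_k)\|$. Then $\nabla f(\mathbf{x}_k) \to \mathbf{0}$. Moreover, for every $\theta \in (0, 1/2]$ for which there exist an open neighborhood $V \subset \mathbb{R}^n$ of $\mathbf{x}^*$ and a constant $c \in \mathbb{R}$ such that for all $k$ $$\mathbf{x}_k \in V \quad\implies\quad \left| f(\mathbf{x}_k) - \lim_{j \to \infty} f(\mathbf{x}_j) \right|^{1-\theta} \le c \|\nabla f(\mathbf{x}_k)\| ,$$ the convergence rate may be estimated,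 as $k \to \infty$, as $$\|\mathbf{x}^* - \mathbf{x}_k\| = \begin{cases} O(q^k) \text{ for some } 0 < q < 1, & \text{if } \theta = \tfrac12, \\ O\left(k^{\frac{-\theta}{1-2\theta}}\right), & \text{if } 0 < \theta < \tfrac12 . \end{cases}$$
   Context: A multivariate rational function on $\mathbb{R}^n$ is a function $r = P/Q$ with $P, Q : \mathbb{R}^n \to \mathbb{R}$ multivariate polynomials; its domain is the set of all points of $\mathbb{R}^n$ at which $Q \neq 0$ (no division by zero occurs). Bounded means bounded on this domain. The point $\mathbf{x}^*$ need not lie in the domain of $f$. Given a bounded multivariate rational function $f = P/Q$ on $\mathbb{R}^n$ (with $Q$ not identically zero) and a point $\mathbf{x}^* \in \mathbb{R}^n$, let $f_j(\mathbf{x})$ denote the $j$-th Maclaurin series coefficient, with respect to $t$, of the denominator $Q(t\mathbf{x} + \mathbf{x}^* )$ of the rational function $(\mathbf{x}, t) \mapsto f(t\mathbf{x} + \mathbf{x}^* )$. Define $$\mathcal{O}_{\mathbf{x}^*} = \{\mathbf{x} \in \mathbb{R}^n : f_{n_{\min}}(\mathbf{x}) \neq 0\}, \qquad n_{\min} = \min\{ j \in \mathbb{Z}_{\ge 0} : \exists\, \mathbf{x} \in \mathbb{R}^n,\ f_j(\mathbf{x}) \neq 0 \}.$$ In (iii), the quotients are taken over those $k$ with $\mathbf{x}_k \neq \mathbf{x}^*$. $\|\cdot\|$ is the Euclidean norm. *)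

(* Defs.v *)
From mathcomp Require mpoly. (* not imported: its notations clash with all_analysis *)
From HB Require Import structures.
From mathcomp Require Import all_boot all_order all_algebra.
From mathcomp Require Import all_classical all_reals all_analysis.
Set Implicit Arguments.
Unset Strict Implicit.
Unset Printing Implicit Defensive.
Import Order.TTheory GRing.Theory Num.Theory.
Import numFieldNormedType.Exports.
Local Open Scope classical_set_scope.
Local Open Scope ring_scope.

Section RationalFunctions.
Context {R : realType} {n : nat}.
Implicit Types (P Q : mpoly.mpoly n R) (x a : 'rV[R]_n).

(* The library's norm `|x| on 'rV[R]_n is the sup norm. *)
Definition enorm x : R := Num.sqrt (\sum_(i < n) x ord0 i ^+ 2).

Definition peval P x : R := mpoly.meval (fun i => x ord0 i) P.

Definition ratfun P Q x : R := peval P x / peval Q x.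

Definition ratdom Q : set 'rV[R]_n := [set x | peval Q x != 0].

Definition rat_bounded P Q : Prop :=
  exists M : R, forall x, ratdom Q x -> `|ratfun P Q x| <= M.

(* Only meaningful where g is differentiable; a rational function is so on its
   (open) domain. *)
Definition grad (g : 'rV[R]_n -> R) x : 'rV[R]_n :=
  \row_(i < n) 'D_(delta_mx ord0 i) g x.

Definition maclaurin_coef (h : R -> R) (j : nat) : R := derive1n j h 0 / j`!%:R.

Definition denom_coef Q a (j : nat) x : R :=
  maclaurin_coef (fun t : R => peval Q (t *: x + a)) j.

(* The minimum is attained as soon as Q is not identically zero; xget's default
   value 0 is used only otherwise. *)
Definition nmin Q a : nat :=
  let S := [set j : nat | exists x, denom_coef Q a j x != 0] in
  xget 0%N [set j | S j /\ forall i : nat, S i -> (j <= i)%N].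

Definition Oset Q a : set 'rV[R]_n :=
  [set x | denom_coef Q a (nmin Q a) x != 0].

End RationalFunctions.

(* Main.v *)
(* Along the tail, (i) makes f(x_k) nonincreasing, hence convergent since f is
   bounded, and (i) with (iv) gives
     sigma * kappa * |grad f(x_k)|^2 <= f(x_k) - f(x_{k+1}) -> 0.
   For the rates put F_k = f(x_k) - lim f. Concavity of the power theta and the
   Lojasiewicz inequality bound |x_{k+1} - x_k| by C (F_k^theta - F_{k+1}^theta)
   while the iterates stay near x*; the path thus has finite length, cannot
   leave a neighbourhood of the cluster point x*, and |x* - x_k| <= C F_k^theta.
   The inequality also gives F_k - F_{k+1} >= m F_k^(2 - 2 theta), a recursion
   that decays geometrically for theta = 1/2 and like k^(-1/(1 - 2 theta))
   otherwise. *)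
Require Import Defs.
From mathcomp Require mpoly.
From HB Require Import structures.
From mathcomp Require Import all_boot all_order all_algebra.
From mathcomp Require Import all_classical all_reals all_analysis.
From mathcomp Require Import ring lra.
Import Order.TTheory GRing.Theory Num.Theory.
Import numFieldNormedType.Exports.
Local Open Scope classical_set_scope.
Local Open Scope ring_scope.

(** * Comparison of the Euclidean norm and the sup norm *)

Lemma enorm_ge0 (R : realType) (n : nat) (v : 'rV[R]_n) : 0 <= enorm v.
Proof. exact: sqrtr_ge0. Qed.

Lemma normr_le_enorm (R : realType) (n : nat) (v : 'rV[R]_n) : `|v| <= enorm v.
Proof.
rewrite [`|v|]mx_normrE; apply: bigmax_le => [|[i j] _ /=].
  exact: enorm_ge0.
rewrite (ord1 i) -sqrtr_sqr ler_wsqrtr// (bigD1 j)//= lerDl.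
by apply: sumr_ge0 => k _; exact: sqr_ge0.
Qed.

Lemma enorm_le_normr (R : realType) (n : nat) (v : 'rV[R]_n) :
  enorm v <= Num.sqrt n%:R * `|v|.
Proof.
have v0 := normr_ge0 v.
rewrite -[X in _ * X]ger0_norm// -sqrtr_sqr -sqrtrM// ler_wsqrtr//.
have -> : n%:R * `|v| ^+ 2 = \sum_(i < n) `|v| ^+ 2.
  by rewrite sumr_const card_ord mulr_natl.
apply: ler_sum => j _.
rewrite -real_normK ?num_real// ler_sqr ?nnegrE ?normr_ge0//.
by rewrite [`|v|]mx_normrE (le_bigmax _ (fun ij => `|v ij.1 ij.2|) (ord0, j)).
Qed.

(** * Tangent inequalities for real powers *)

(** Young's inequality for the product of [a]^ (1 - theta)[and]b [^ theta], rearranged. It is the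
    tangent bound at [a] cleared of its denominator, so that [a = 0] is allowed. *)
Lemma powR_concave_tangent (R : realType) (theta a b : R) :
  0 < theta < 1 -> 0 <= a -> 0 <= b ->
  theta * (a - b) <= a `^ (1 - theta) * (a `^ theta - b `^ theta).
Proof.
move=> /andP[t0 t1] a0 b0; have t1' : 0 < 1 - theta by rewrite subr_gt0.
have := @conjugate_powR R (a `^ (1 - theta)) (b `^ theta) (1 - theta)^-1
  theta^-1 (powR_ge0 _ _) (powR_ge0 _ _).
rewrite !invr_gt0 !invrK subrK => /(_ t1' t0 erefl).
rewrite -!powRrM !mulfV ?gt_eqF// !powRr1// => young.
rewrite [leRHS]mulrBr -powRD ?subrK ?oner_eq0// powRr1//.
by move: young; lra.
Qed.

(** Scaling by [a] reduces this to the tangent at 1, which follows from [exp u >= 1 + u] with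
    [u = - beta * ln s] and from [ln s <= s - 1]. *)
Lemma powR_convex_tangent (R : realType) (beta a b : R) :
  0 < beta -> 0 < a -> 0 < b ->
  a `^ (- beta) + beta * a `^ (- (1 + beta)) * (a - b) <= b `^ (- beta).
Proof.
move=> beta0 a0 b0; set s := b / a.
have s0 : 0 < s by rewrite divr_gt0.
have -> : b = a * s by rewrite /s mulrCA mulfV ?mulr1 ?gt_eqF.
have an0 : a != 0 by rewrite gt_eqF.
rewrite opprD powRD ?an0 ?implybT// powRM ?(ltW a0) ?(ltW s0)//.
rewrite powR_inv1 ?(ltW a0)//.
have -> : a `^ (- beta) + beta * (a^-1 * a `^ (- beta)) * (a - a * s) =
    a `^ (- beta) * (1 + beta * (1 - s)) by field.
rewrite ler_wpM2l ?powR_ge0//.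
rewrite /powR gt_eqF//; apply: le_trans (expR_ge1Dx _).
rewrite lerD2l mulNr -mulrN ler_wpM2l ?(ltW beta0)//.
have : ln (1 + (s - 1)) <= s - 1 by apply: le_ln1Dx; lra.
by rewrite addrC subrK; lra.
Qed.

(** * Vanishing potentials and trapping near a cluster point *)

Lemma cvg_powR0 (R : realType) (theta : R) (F : nat -> R) : 0 < theta ->
  (\forall k \near \oo, 0 <= F k) -> F @ \oo --> 0 ->
  (fun k => F k `^ theta) @ \oo --> 0.
Proof.
move=> t0 F0 F_cvg; apply/cvgr0Pnorm_lt => e e0.
have r0 : 0 < e `^ theta^-1 by rewrite powR_gt0.
near=> k; rewrite ger0_norm ?powR_ge0//.
have -> : e = (e `^ theta^-1) `^ theta.
  by rewrite -powRrM mulVf ?gt_eqF// powRr1// ltW.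
have Fk0 : 0 <= F k by near: k.
rewrite gt0_ltr_powR ?nnegrE ?(ltW r0)// -[F k]ger0_norm//.
by near: k; exact: (cvgr0_norm_lt _ F_cvg).
Unshelve. all: by end_near. Qed.

(* Once an iterate is within r/2 of the cluster point with phi < r/2, the
   telescoped length of the remaining path keeps all iterates in the r-ball. *)
Lemma cluster_trapping (R : realType) (V : normedModType R) (x : nat -> V)
  (a : V) (phi : nat -> R) (r : R) : 0 < r ->
  cluster (x @ \oo) a -> (forall k, 0 <= phi k) -> phi @ \oo --> 0 ->
  (\forall k \near \oo, `|x k - a| < r ->
     `|x k.+1 - x k| <= phi k - phi k.+1) ->
  \forall k \near \oo, `|x k - a| < r /\ `|a - x k| <= phi k.
Proof.
move=> r0 xa phi0 phi_cvg [N _ step].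
have r20 : 0 < r / 2 by rewrite divr_gt0.
have [M _ phi_small] := cvgr0_norm_lt _ phi_cvg _ r20.
have visit e j : 0 < e -> exists2 k, (j <= k)%N & `|x k - a| < e.
  move=> e0; have [|y [[k jk <-] yk]] := xa (x @` [set k | (j <= k)%N])
      (ball a e) _ (nbhsx_ballx a e e0).
    by exists j => // k jk; exists k.
  by exists k => //; rewrite distrC -ball_normE in yk *.
have [K NMK xK] := visit _ (maxn N M) r20.
have [NK MK] : (N <= K)%N /\ (M <= K)%N by apply/andP; rewrite -geq_max.
have phiK : phi K < r / 2 by rewrite -[phi K]ger0_norm //; exact: phi_small.
(* The two bounds are proved together: the length bound puts the iterate in the ball, and being in
   the ball licenses the next step. *)
have path k : `|x (K + k)%N - x K| <= phi K - phi (K + k)%N /\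
              `|x (K + k)%N - a| < r.
  have close m : `|x (K + m)%N - x K| <= phi K - phi (K + m)%N ->
                 `|x (K + m)%N - a| < r.
    move=> h; have := ler_distD (x K) (x (K + m)%N) a.
    by have := phi0 (K + m)%N; move: h phiK xK; lra.
  elim: k => [|k [IHk xk]]; last first.
    suff h : `|x (K + k.+1)%N - x K| <= phi K - phi (K + k.+1)%N.
      by split => //; exact: close.
    have := step _ (leq_trans NK (leq_addr k K)) xk.
    have := ler_distD (x (K + k)%N) (x (K + k.+1)%N) (x K).
    by rewrite addnS; move: IHk; lra.
  by split; [rewrite addn0 !subrr normr0|apply: close; rewrite addn0 !subrr normr0].
(* With every iterate past [K] in the ball, the telescoping can restart from any later index. *)
have {}path k : (K <= k)%N -> `|x k - a| < r /\
    forall j, `|x (k + j)%N - x k| <= phi k - phi (k + j)%N.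
  move=> Kk; have inr m : (K <= m)%N -> `|x m - a| < r.
    by move=> Km; rewrite -(subnKC Km); have [] := path (m - K)%N.
  split; first exact: inr.
  elim=> [|j IHj]; first by rewrite addn0 !subrr normr0.
  have Kkj : (K <= k + j)%N by rewrite (leq_trans Kk)// leq_addr.
  have := step _ (leq_trans NK Kkj) (inr _ Kkj).
  have := ler_distD (x (k + j)%N) (x (k + j.+1)%N) (x k).
  by rewrite addnS; move: IHj; lra.
exists K => // k /= Kk; have [xk tail] := path _ Kk; split => //.
(* A late visit [x j] within [e] of [a] stands in for the limit; [phi j >= 0] is dropped. *)
apply/ler_addgt0Pr => e e0; have [j kj xj] := visit e k e0.
have := tail (j - k)%N; rewrite subnKC// => len.
have := ler_distD (x j) a (x k); rewrite (distrC a (x j)).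
by have := phi0 j; move: len xj; lra.
Unshelve. all: by end_near. Qed.

(** * Decay rates from recursive decrease *)

Lemma linear_decrease_rate (R : realType) (m : R) (F : nat -> R) : 0 < m ->
  (\forall k \near \oo, 0 <= F k) ->
  (\forall k \near \oo, m * F k <= F k - F k.+1) ->
  exists M q : R, [/\ 0 <= M, 0 < q < 1 &
    \forall k \near \oo, F k <= M * q ^+ k].
Proof.
move=> m0 F0 Fdec.
(* The maximum keeps the ratio positive when [m >= 1]. *)
pose q := Num.max (1 - m) 2^-1.
have q0 : 0 < q by rewrite /q lt_max invr_gt0 ltr0n orbT.
have q1 : q < 1 by rewrite /q gt_max gtrBl m0/= invf_lt1// ltr1n.
have [K _ FK] : \forall k \near \oo, 0 <= F k /\ F k.+1 <= q * F k.
  near=> k; have Fk0 : 0 <= F k by near: k.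
  split => //; apply: (@le_trans _ _ ((1 - m) * F k)).
    by rewrite mulrBl mul1r lerBrDl -lerBrDr; near: k.
  by rewrite ler_wpM2r// /q le_max lexx.
exists (F K / q ^+ K), q; split; rewrite ?q0//.
  by rewrite divr_ge0 ?exprn_ge0 ?(ltW q0)//; have [] := FK K (leqnn K).
exists K => // k /= Kk; rewrite -(subnKC Kk).
elim: (k - K)%N => [|j IHj].
  by rewrite addn0 divfK// expf_neq0// gt_eqF.
have [_] := FK (K + j)%N (leq_addr _ _); rewrite addnS => /le_trans; apply.
by rewrite exprS mulrCA ler_wpM2l// ltW.
Unshelve. all: by end_near. Qed.

(* By convexity, F k `^ (- beta) increases by at least beta * m per step, as
   long as F k does not vanish. *)
Lemma power_decrease_rate (R : realType) (m beta : R) (F : nat -> R) :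
  0 < m -> 0 < beta -> (\forall k \near \oo, 0 <= F k) ->
  (\forall k \near \oo, m * F k `^ (1 + beta) <= F k - F k.+1) ->
  exists2 M : R, 0 <= M & \forall k \near \oo, F k <= M * k%:R `^ (- beta^-1).
Proof.
move=> m0 b0 F0 Fdec.
have [K _ FK] : \forall k \near \oo,
    0 <= F k /\ m * F k `^ (1 + beta) <= F k - F k.+1.
  by near=> k; split; near: k.
have bm0 : 0 < beta * m / 2 by rewrite divr_gt0// mulr_gt0.
have grow j : 0 < F (K + j)%N -> beta * m * j%:R <= F (K + j)%N `^ (- beta).
  elim: j => [|j IHj] Fj1; first by rewrite mulr0 powR_ge0.
  have [Fj0 dec] := FK (K + j)%N (leq_addr _ _).
  (* Positivity passes backwards because [F] is nonincreasing here. *)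
  have Fj : 0 < F (K + j)%N.
    apply: lt_le_trans Fj1 _; rewrite addnS -subr_ge0.
    by apply: le_trans dec; rewrite mulr_ge0 ?powR_ge0// ltW.
  apply: le_trans (powR_convex_tangent _ _ _ _ b0 Fj Fj1).
  rewrite -natr1 mulrDr mulr1 lerD ?IHj// -mulrA ler_wpM2l ?(ltW b0)//.
  by rewrite addnS powRN mulrC ler_pdivlMr ?powR_gt0.
exists ((beta * m / 2) `^ (- beta^-1)); first exact: powR_ge0.
(* Beyond [2 * K] one has [k - K >= k / 2], whence the factor 1/2 in the constant. *)
exists (2 * K).+1 => // k /= Kk.
have KK : (K <= k)%N by rewrite (leq_trans _ Kk)// leqW// leq_pmull.
have [Fk0 _] := FK k KK.
have k0 : 0 < k%:R :> R by rewrite ltr0n (leq_trans _ Kk).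
have [->|Fk] := eqVneq (F k) 0; first by rewrite mulr_ge0 ?powR_ge0.
have {}Fk : 0 < F k by rewrite lt0r Fk.
rewrite -powRM ?(ltW bm0) ?(ltW k0)//.
have lin : beta * m / 2 * k%:R <= F k `^ (- beta).
  have := grow (k - K)%N; rewrite subnKC// => /(_ Fk); apply: le_trans.
  rewrite -mulrA ler_wpM2l ?mulr_ge0 ?(ltW m0) ?(ltW b0)// natrB//.
  have : (2 * K)%:R <= k%:R :> R by rewrite ler_nat ltnW.
  by rewrite natrM; lra.
have -> : F k = ((F k `^ (- beta)) `^ beta^-1)^-1.
  by rewrite -powRrM mulNr mulfV ?gt_eqF// powR_inv1 ?invrK// ltW.
rewrite [leRHS]powRN lef_pV2 ?posrE ?powR_gt0 ?mulr_gt0//.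
by rewrite ge0_ler_powR ?nnegrE ?invr_ge0 ?powR_ge0 ?(ltW b0)// mulr_ge0 ?ltW.
Unshelve. all: by end_near. Qed.

(** * Descent and the Lojasiewicz inequality *)

Lemma descent_gradient_cvg0 (R : realType) (mu : R) (f g : nat -> R) :
  0 < mu -> (forall k, 0 <= g k) -> cvgn f ->
  (\forall k \near \oo, mu * g k ^+ 2 <= f k - f k.+1) -> g @ \oo --> 0.
Proof.
move=> mu0 g0 f_cvg dec; apply/cvgr0Pnorm_lt => e e0.
have f_step : (fun k => f k - f k.+1) @ \oo --> 0.
  rewrite -(subrr (limn f)); apply: cvgB => //.
  by rewrite (cvg_shiftS f).
have me0 : 0 < mu * e ^+ 2 by rewrite mulr_gt0// exprn_gt0.
near=> k; rewrite ger0_norm// -ltr_sqr ?nnegrE ?(ltW e0)//.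
rewrite -(ltr_pM2l mu0); apply: (@le_lt_trans _ _ (f k - f k.+1)).
  by near: k.
apply: le_lt_trans (ler_norm _) _.
by near: k; exact: (cvgr0_norm_lt _ f_step).
Unshelve. all: by end_near. Qed.

(** The concave tangent bound and [loj] give [theta * (F - F') <= c * g * (F]^ theta - F'
    [^ theta)]; combining with [dec] and cancelling [g] bounds [d]. *)
Lemma lojasiewicz_step (R : realType) (theta sigma c F F' g d : R) :
  0 < theta < 1 -> 0 < sigma -> 0 < c -> 0 <= F' <= F -> 0 <= g -> 0 <= d ->
  sigma * g * d <= F - F' -> (F = F' -> d = 0) -> F `^ (1 - theta) <= c * g ->
  d <= c / (sigma * theta) * F `^ theta - c / (sigma * theta) * F' `^ theta.
Proof.
move=> /andP[t0 t1] s0 c0 /andP[F'0 F'F] g0 d0 dec stop loj.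
have F0 : 0 <= F := le_trans F'0 F'F.
have le_pow : 0 <= F `^ theta - F' `^ theta.
  by rewrite subr_ge0 ge0_ler_powR ?nnegrE ?(ltW t0).
rewrite -mulrBr mulrAC ler_pdivlMr ?mulr_gt0//.
(* Where [g] cannot be cancelled, [loj] forces [F = 0], hence [F' = 0], and [stop] gives [d = 0]. *)
have [gE|gN0] := eqVneq g 0.
  have FE : F = 0.
    apply: (@powR_eq0_eq0 _ _ (1 - theta)); apply/eqP.
    by rewrite eq_le powR_ge0 andbT; move: loj; rewrite gE mulr0.
  rewrite stop ?mul0r ?mulr_ge0 ?(ltW c0)//.
  by apply/eqP; rewrite eq_le F'F FE F'0.
have {}g0 : 0 < g by rewrite lt0r gN0.
rewrite -(ler_pM2l g0).
have := powR_concave_tangent _ theta F F'; rewrite t0 t1 => /(_ isT F0 F'0).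
have := ler_wpM2r le_pow loj.
have := ler_wpM2l (ltW t0) dec.
by lra.
Qed.

(* F k, g k and d k play the roles of f(x_k) - lim f, of the gradient norm and
   of the Euclidean step length; the iterates are measured in the norm of V. *)
Lemma lojasiewicz_descent_rate (R : realType) (V : normedModType R)
    (x : nat -> V) (a : V) (F g d : nat -> R) (theta sigma kappa c r : R) :
  0 < theta <= 2^-1 -> 0 < sigma -> 0 < kappa -> 0 < c -> 0 < r ->
  cluster (x @ \oo) a -> F @ \oo --> 0 ->
  (forall k, 0 <= g k) -> (forall k, `|x k.+1 - x k| <= d k) ->
  (\forall k \near \oo, 0 <= F k) ->
  (\forall k \near \oo, sigma * g k * d k <= F k - F k.+1) ->
  (\forall k \near \oo, F k = F k.+1 -> d k = 0) ->
  (\forall k \near \oo, kappa * g k <= d k) ->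
  (\forall k \near \oo, `|x k - a| < r -> F k `^ (1 - theta) <= c * g k) ->
  exists2 M, 0 <= M &
    (theta = 2^-1 -> exists2 q : R, 0 < q < 1 &
       \forall k \near \oo, `|a - x k| <= M * q ^+ k) /\
    (theta < 2^-1 ->
       \forall k \near \oo,
         `|a - x k| <= M * k%:R `^ (- theta / (1 - 2 * theta))).
Proof.
move=> /andP[t0 t12] s0 k0 c0 r0 xa F_cvg g0 xd F0 dec stop long loj.
have t1 : theta < 1 by lra.
have d0 k : 0 <= d k by exact: le_trans (xd k).
pose C := c / (sigma * theta).
have C0 : 0 < C by rewrite divr_gt0// mulr_gt0.
have F0S : \forall k \near \oo, 0 <= F k.+1.
  by case: F0 => N _ FN; exists N => // k Nk; exact/FN/leqW.
have mono : \forall k \near \oo, 0 <= F k.+1 <= F k.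
  near=> k; apply/andP; split; first by near: k.
  rewrite -subr_ge0; apply: (@le_trans _ _ (sigma * g k * d k)); last by near: k.
  by rewrite !mulr_ge0 ?(ltW s0).
have trap : \forall k \near \oo, `|x k - a| < r /\
    `|a - x k| <= C * F k `^ theta.
  apply: cluster_trapping => //.
  - by move=> k; rewrite mulr_ge0 ?powR_ge0// ltW.
  - rewrite -(mulr0 C); by apply: cvgM; [exact: cvg_cst|exact: cvg_powR0].
  near=> k => xk; apply: le_trans (xd k) _.
  apply: (@lojasiewicz_step _ _ _ _ _ _ (g k)) => //; first by rewrite t0.
  + by near: k.
  + by near: k.
  + by near: k.
  + by move: xk; near: k.
pose m := sigma * kappa / c ^+ 2.
have m0 : 0 < m by rewrite divr_gt0 ?mulr_gt0// exprn_gt0.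
have Fdec : \forall k \near \oo, m * F k `^ (1 + (1 - 2 * theta)) <= F k - F k.+1.
  near=> k; apply: (@le_trans _ _ (sigma * g k * d k)); last by near: k.
  have xk : `|x k - a| < r by near: k; apply: filterS trap => k [].
  have lojk : F k `^ (1 - theta) <= c * g k by move: xk; near: k.
  have longk : kappa * g k <= d k by near: k.
  have -> : 1 + (1 - 2 * theta) = (1 - theta) * 2 by ring.
  rewrite powRrM powR_mulrn ?powR_ge0// /m mulrAC ler_pdivrMr ?exprn_gt0//.
  have := powR_ge0 (F k) (1 - theta); set p := F k `^ _ => p0.
  have p2 : p ^+ 2 <= (c * g k) ^+ 2 by rewrite ler_sqr ?nnegrE ?mulr_ge0 ?(ltW c0).
  have sk0 : 0 <= sigma * kappa by rewrite mulr_ge0 ?ltW.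
  apply: le_trans (ler_wpM2l sk0 p2) _.
  have -> : sigma * kappa * (c * g k) ^+ 2 =
    sigma * g k * (kappa * g k) * c ^+ 2 by ring.
  by rewrite ler_wpM2r ?sqr_ge0// ler_wpM2l// mulr_ge0 ?(ltW s0).
(* At 1/2 the exponent in [Fdec] is 1 and the recursion is linear; below it the excess
   [1 - 2 * theta] is positive and plays [beta]. *)
have [tE|tN] := eqVneq theta 2^-1.
  have [M [q [M0 /andP[q0 q1] FM]]] : exists M q : R, [/\ 0 <= M, 0 < q < 1 &
      \forall k \near \oo, F k <= M * q ^+ k].
    apply: (linear_decrease_rate _ _ _ m0 F0).
    near=> k; have : m * F k `^ (1 + (1 - 2 * theta)) <= F k - F k.+1 by near: k.
    rewrite tE divff ?pnatr_eq0// subrr addr0 powRr1//.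
    by near: k.
  exists (C * M `^ theta); first by rewrite mulr_ge0 ?powR_ge0 ?ltW.
  split => [_|]; last by rewrite tE ltxx.
  exists (q `^ theta).
    have -> : 1 = 1 `^ theta :> R by rewrite powR1.
    by rewrite powR_gt0//= gt0_ltr_powR ?nnegrE ?(ltW q0)//.
  near=> k; have [_ xk] : `|x k - a| < r /\ `|a - x k| <= C * F k `^ theta.
    by near: k.
  apply: le_trans xk _; rewrite -[leRHS]mulrA ler_wpM2l ?(ltW C0)//.
  rewrite -powR_mulrn ?powR_ge0// powRAC powR_mulrn ?(ltW q0)//.
  rewrite -powRM ?exprn_ge0 ?(ltW q0)//.
  have Fk0 : 0 <= F k by near: k.
  by rewrite ge0_ler_powR ?nnegrE ?mulr_ge0 ?exprn_ge0 ?(ltW t0) ?(ltW q0)//; near: k.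
have {tN}tlt : theta < 2^-1 by rewrite lt_neqAle tN.
have b0 : 0 < 1 - 2 * theta by lra.
have [M M0 FM] := power_decrease_rate _ _ _ _ m0 b0 F0 Fdec.
exists (C * M `^ theta); first by rewrite mulr_ge0 ?powR_ge0 ?ltW.
split => [tE|_]; first by rewrite tE ltxx in tlt.
near=> k; have [_ xk] : `|x k - a| < r /\ `|a - x k| <= C * F k `^ theta.
  by near: k.
apply: le_trans xk _; rewrite -[leRHS]mulrA ler_wpM2l ?(ltW C0)//.
have -> : - theta / (1 - 2 * theta) = - (1 - 2 * theta)^-1 * theta by ring.
rewrite powRrM -powRM ?powR_ge0//.
have Fk0 : 0 <= F k by near: k.
by rewrite ge0_ler_powR ?nnegrE ?mulr_ge0 ?powR_ge0 ?(ltW t0)//; near: k.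
Unshelve. all: by end_near. Qed.

(** * Descent sequences of bounded rational functions *)

Theorem theorem2p12 (R : realType) (n : nat) (P Q : mpoly.mpoly n R)
  (Q_neq0 : exists y : 'rV[R]_n, peval Q y != 0)
  (f_bounded : rat_bounded P Q)
  (x : nat -> 'rV[R]_n) (xstar : 'rV[R]_n)
  (x_dom : forall k : nat, (0 < k)%N -> ratdom Q (x k))
  (x_cluster : cluster (x @ \oo) xstar)
  (cond_i : exists2 sigma : R, 0 < sigma &
     \forall k \near \oo,
       ratfun P Q (x k) - ratfun P Q (x k.+1) >=
       sigma * enorm (grad (ratfun P Q) (x k)) * enorm (x k.+1 - x k))
  (cond_ii : \forall k \near \oo,
     ratfun P Q (x k) = ratfun P Q (x k.+1) -> x k = x k.+1)
  (cond_iii :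
     cluster ((fun k : nat => (enorm (x k - xstar))^-1 *: (x k - xstar))
              @ within [set k : nat | x k != xstar] \oo)
     `<=` Oset Q xstar)
  (cond_iv : exists2 kappa : R, 0 < kappa &
     \forall k \near \oo,
       enorm (x k.+1 - x k) >= kappa * enorm (grad (ratfun P Q) (x k))) :
  ((fun k : nat => grad (ratfun P Q) (x k)) @ \oo --> (0 : 'rV[R]_n)) /\
  (forall theta : R, 0 < theta -> theta <= 2^-1 ->
     (exists (V : set 'rV[R]_n) (c : R),
        [/\ open V, V xstar &
            forall k : nat, (0 < k)%N -> V (x k) ->
              `| ratfun P Q (x k)
                 - lim ((fun j : nat => ratfun P Q (x j)) @ \oo) |
                `^ (1 - theta)
              <= c * enorm (grad (ratfun P Q) (x k))]) ->
     (theta = 2^-1 ->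
        exists2 q : R, 0 < q < 1 &
          (fun k : nat => enorm (xstar - x k)) =O_\oo (fun k : nat => q ^+ k))
     /\
     (theta < 2^-1 ->
        (fun k : nat => enorm (xstar - x k)) =O_\oo
        (fun k : nat => k%:R `^ (- theta / (1 - 2 * theta))))).
Proof.
case: cond_i => sigma s0 dec; case: cond_iv => kappa k0 long.
pose f k := ratfun P Q (x k); pose g k := enorm (grad (ratfun P Q) (x k)).
pose d k := enorm (x k.+1 - x k).
have g0 k : 0 <= g k by exact: enorm_ge0.
have [N _ mono] : \forall k \near \oo, f k.+1 <= f k.
  near=> k; rewrite -subr_ge0; apply: (@le_trans _ _ (sigma * g k * d k)).
    by rewrite !mulr_ge0 ?enorm_ge0 ?(ltW s0).
  by near: k.
have {}mono k j : (N <= k)%N -> (k <= j)%N -> f j <= f k.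
  move=> Nk kj; rewrite -(subnKC kj); elim: (j - k)%N => [|i IHi].
    by rewrite addn0.
  by rewrite addnS (le_trans _ IHi)//; apply: mono; rewrite /= (leq_trans Nk) ?leq_addr.
have f_cvg : cvgn f.
  case: f_bounded => M fM; apply: (@near_nonincreasing_is_cvgn _ _ (- M)).
    by exists N => // k Nk j; exact: mono.
  (* The sequence is indexed from 1, so [x 0] may lie outside the domain. *)
  exists 1%N => // k k1; have := fM _ (x_dom k k1).
  by rewrite ler_norml => /andP[].
have f_lim : \forall k \near \oo, limn f <= f k.
  exists N => // k Nk; apply: limr_le => //.
  by exists k => // j; exact: mono.
have grad_cvg : g @ \oo --> 0.
  apply: (@descent_gradient_cvg0 _ (sigma * kappa) f) => //; first exact: mulr_gt0.
  near=> k; apply: (@le_trans _ _ (sigma * g k * d k)); last by near: k.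
  have -> : sigma * kappa * g k ^+ 2 = sigma * g k * (kappa * g k) by ring.
  by rewrite ler_wpM2l ?mulr_ge0 ?(ltW s0)//; near: k.
split.
  apply/cvgr0Pnorm_lt => e e0; near=> k.
  apply: le_lt_trans (normr_le_enorm _ _ _) _.
  rewrite -[enorm _](@ger0_norm R) ?enorm_ge0//.
  by near: k; exact: (cvgr0_norm_lt _ grad_cvg).
move=> theta t0 t12 [V [c [Vopen Vx loj]]].
have [r /= r0 rV] : nbhs_ball xstar V.
  by apply/nbhs_ballP; exact: open_nbhs_nbhs.
(* The given [c] may have any sign; enlarging it preserves the inequality. *)
have c0 : 0 < Num.max c 1 by rewrite lt_max ltr01 orbT.
have t0t : 0 < theta <= 2^-1 by rewrite t0.
have [||||||||M M0 [rate1 rate2]] := @lojasiewicz_descent_rate R _ x xstar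
    (fun k => f k - limn f) g d theta sigma kappa (Num.max c 1) r t0t s0 k0 c0 r0 x_cluster.
- rewrite -(subrr (limn f)); apply: cvgB => //; exact: cvg_cst.
- exact: g0.
- by move=> k; exact: normr_le_enorm.
- by near=> k; rewrite subr_ge0; near: k.
- by near=> k; rewrite opprB addrA subrK; near: k.
- near=> k => /addIr fk; rewrite /d -(_ : x k = x k.+1).
    by rewrite subrr; apply/eqP; rewrite sqrtr_eq0 big1// => i _; rewrite mxE expr0n.
  by move: fk; near: k.
- exact: long.
- near=> k => xk.
  have fk : 0 <= f k - limn f by rewrite subr_ge0; near: k.
  rewrite -(ger0_norm fk); apply: le_trans (loj k _ _) _.
  + by near: k; exists 1%N.
  + by apply: rV; rewrite -ball_normE /= distrC.
  + by rewrite ler_wpM2r ?enorm_ge0// le_max lexx.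
have bigO (u : nat -> R) : (\forall k \near \oo, `|xstar - x k| <= M * u k) ->
    (fun k => enorm (xstar - x k)) =O_\oo u.
  move=> Mu; apply/eqO_exP.
  have C0 : 0 <= Num.sqrt n%:R * M by rewrite mulr_ge0 ?sqrtr_ge0.
  (* [Num.sqrt n%:R] converts the sup norm to the Euclidean one; adding 1 makes the constant
     positive even if [n] or [M] is 0. *)
  exists (Num.sqrt n%:R * M + 1); first exact: ltr_pwDr.
  near=> k; rewrite ger0_norm ?enorm_ge0//.
  apply: le_trans (enorm_le_normr _ _ _) _.
  have xk : `|xstar - x k| <= M * u k by near: k.
  apply: le_trans (ler_wpM2l (sqrtr_ge0 _) xk) _.
  rewrite mulrA mulrDl mul1r; apply: le_trans (ler_wpM2l C0 (ler_norm _)) _.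
  by rewrite lerDl.
split=> [/rate1[q q01 xq]|/rate2]; last exact: bigO.
by exists q => //; exact: bigO.
Unshelve. all: by end_near. Qed.
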